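(* Let $d\in\mathbb{N}$, let $I\subset\mathbb{Z}^d$ be a finite nonempty set of cardinality $T$, let $\delta\in(0,1)$, $c>1$ and $n\in\mathbb{N}$. Let $\lambda\in\mathbb{R}$ satisfy $\lambda\ge c(T-1)$ and put $$s=\left\lceil\left(\frac{c}{c-1}\right)^2\frac{\ln T-\ln\delta}{2}\right\rceil .$$ Choose lattice sizes $M_1,\dots,M_s$ from $P^I_{\lambda,n}$ at random in one of the following two ways: (i) with replacement (independently, so that the $M_\ell$ are not necessarily distinct), or (ii) without replacement (so that the $M_\ell$ are pairwise distinct), where in this case $n\ge s$ is assumed. Then, for each $\ell=1,\dots,s$, choose a generating vector $\boldsymbol z_\ell\in[0,M_\ell-1]^d\cap\mathbb{Z}^d$ uniformly at random, independently of the other choices. In either case, the probability that the Fourier matrix $\boldsymbol A\left(\bigcup_{\ell=1}^s\Lambda(\boldsymbol z_\ell,M_\ell),I\right)$ has full column rank is at least $1-\delta$.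
   Context: For $\boldsymbol z\in\mathbb{Z}^d$ and $M\in\mathbb{N}$, the rank-1 lattice is $\Lambda(\boldsymbol z,M)=\{\frac{j}{M}\boldsymbol z\bmod\boldsymbol 1: j=0,\dots,M-1\}\subset[0,1)^d$ (componentwise modulo 1). For a finite set $\mathcal X\subset[0,1)^d$ the Fourier matrix is $\boldsymbol A(\mathcal X,I)=\left(e^{2\pi i\,\boldsymbol k\cdot\boldsymbol x}\right)_{\boldsymbol x\in\mathcal X,\ \boldsymbol k\in I}$ (rows indexed by $\mathcal X$, columns by $I$); repeating rows for nodes that belong to several of the lattices does not affect the column rank. For $M\in\mathbb{N}$, $I_{\bmod M}:=\{\boldsymbol k\bmod M:\boldsymbol k\in I\}$, where $\boldsymbol k\bmod M\in\{0,\dots,M-1\}^d$ is taken componentwise. $P^I:=\{M\in\mathbb{N}: M\text{ prime and }|I_{\bmod M}|=|I|\}$. $P^I_{\lambda,n}$ denotes the set of the $n$ smallest elements of $P^I$ that are larger than $\lambda$. Choosing ''at random'' from a finite set means uniformly. *)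

(* Defs.v *)
From HB Require Import structures.
From mathcomp Require Import all_boot all_order all_algebra finmap.
From mathcomp Require Import all_classical all_reals all_analysis complex.
From mathcomp Require Import zify.

Set Implicit Arguments.
Unset Strict Implicit.
Unset Printing Implicit Defensive.
Import Order.TTheory GRing.Theory Num.Theory.
Local Open Scope ring_scope.

(** * Rank-1 lattices and Fourier matrices *)

Section lattices.
Variables (R : realType) (d : nat).

(* componentwise x mod 1, in [0, 1)^d *)
Definition fract_vec (x : 'rV[R]_d) : 'rV[R]_d :=
  map_mx (fun t => t - (Num.floor t)%:~R) x.

Definition rank1_lattice (z : 'rV[int]_d) (M : nat) : {fset 'rV[R]_d} :=
  [fset fract_vec ((j%:R / M%:R) *: map_mx intr z) | j in iota 0 M]%fset.

(* exp(2 pi i t) *)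
Definition expi2pi (t : R) : R[i] :=
  Complex (cos (2 * pi * t)) (sin (2 * pi * t)).

Definition dotp (k : 'rV[int]_d) (x : 'rV[R]_d) : R :=
  \sum_(a < d) (k 0 a)%:~R * x 0 a.

(* Row p (column q) belongs to the p-th node of X (q-th frequency of I) in the
   duplicate-free enumerations underlying the finite sets X and I. *)
Definition fourier_mx (X : {fset 'rV[R]_d}) (I : {fset 'rV[int]_d}) :
    'M[R[i]]_(#|` X|, #|` I|) :=
  \matrix_(p, q) expi2pi (dotp (nth 0 I q) (nth 0 X p)).

End lattices.

Definition full_column_rank (F : fieldType) (m n : nat) (A : 'M[F]_(m, n)) :=
  \rank A == n.

(* M is among the n smallest elements of Q iff fewer than n elements of Q are
   below M. The set is finite, with exactly n elements, whenever Q is infinite. *)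
Definition n_smallest_set (Q : pred nat) (n : nat) : set nat :=
  [set M | Q M /\ (count Q (iota 0 M) < n)%N]%classic.

Definition n_smallest (Q : pred nat) (n : nat) : {fset nat} :=
  fset_set (n_smallest_set Q n).

Lemma card_n_smallest (Q : pred nat) n :
  (forall N, exists2 M, (N < M)%N & Q M) ->
  finite_set (n_smallest_set Q n) /\ #|` n_smallest Q n| = n.
Proof.
move=> Qinf; rewrite /n_smallest; set S := n_smallest_set Q n.
have rankS x m : count Q (iota 0 (x.+1 + m)) =
    (count Q (iota 0 x) + Q x + count Q (iota x.+1 m))%N.
  by rewrite iotaD -[in iota 0 _](addn1 x) iotaD !count_cat /= addn0.
have rank_lt x y : Q x -> (x < y)%N -> (count Q (iota 0 x) < count Q (iota 0 y))%N.
  by move=> Qx ltxy; rewrite -(subnKC ltxy) rankS Qx addn1 leq_addr.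
have ex_rank i : exists2 x, Q x & count Q (iota 0 x) = i.
  elim: i => [|i [x Qx <-]].
    have [y _ Qy] := Qinf 0; have ex_Q : exists y, Q y by exists y.
    exists (ex_minn ex_Q); case: ex_minnP => // m _ min_m.
    apply/eqP; rewrite eqn0Ngt -has_count; apply/hasPn => q.
    by rewrite mem_iota add0n => /= ltqm; apply/negP => /min_m; rewrite leqNgt ltqm.
  have ex_Q : exists y, (x < y)%N && Q y.
    by have [y lty Qy] := Qinf x; exists y; rewrite lty.
  exists (ex_minn ex_Q); case: ex_minnP => // m /andP[ltxm Qm] min_m //.
  rewrite -(subnKC ltxm) rankS Qx addn1; apply/eqP.
  rewrite -[X in _ == X]addn0 eqn_add2l eqn0Ngt -has_count; apply/hasPn => q.
  rewrite mem_iota subnKC // => /andP[ltxq ltqm]; apply/negP => Qq.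
  by have := min_m q; rewrite ltxq Qq leqNgt ltqm => /(_ isT).
have [f fP] : {f : nat -> nat & forall i, Q (f i) /\ count Q (iota 0 (f i)) = i}.
  by apply: (@choice _ _ (fun i x => Q x /\ count Q (iota 0 x) = i)) => i;
     have [x ? ?] := ex_rank i; exists x.
have fK : cancel f (fun x => count Q (iota 0 x)) by move=> i; have [] := fP i.
have -> : S = [set` [fset f i | i in iota 0 n]%fset]%classic.
  apply/seteqP; split=> x /=.
    move=> [Qx ltx]; apply/imfsetP; exists (count Q (iota 0 x)).
      by rewrite /= mem_iota.
    have [Qf Ef] := fP (count Q (iota 0 x)).
    have [//|] := eqVneq x (f (count Q (iota 0 x))).
    by rewrite neq_ltn => /orP[] /rank_lt; [move/(_ Qx)|move/(_ Qf)];
       rewrite Ef ltnn.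
  move=> /imfsetP[i /=]; rewrite mem_iota => lti ->.
  by rewrite /S /n_smallest_set /=; have [? ->] := fP i.
split; first exact: finite_fset.
rewrite set_fsetK card_imfset; last exact: can_inj fK.
by rewrite /= undup_id ?iota_uniq ?size_iota.
Qed.

(** * Admissible lattice sizes *)

Section sizes.
Variables (d : nat) (I : {fset 'rV[int]_d}).

Definition mod_vec (M : nat) (k : 'rV[int]_d) : 'rV[int]_d :=
  map_mx (fun a => (a %% M%:Z)%Z) k.

Definition mod_freqs (M : nat) : {fset 'rV[int]_d} :=
  [fset mod_vec M k | k in I]%fset.

Definition lattice_size : pred nat :=
  fun M => prime M && (#|` mod_freqs M| == #|` I|).

Lemma lattice_size_unbounded N : exists2 M, (N < M)%N & lattice_size M.
Proof.
pose B := (\sum_(k <- enum_fset I) \sum_(a < d) `|k 0%R a|)%N.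
have ltB (k : 'rV[int]_d) a : k \in I -> (`|k 0%R a| <= B)%N.
  move=> kI; rewrite /B (big_rem k) //= (bigD1 a) //= -addnA; exact: leq_addr.
have [M ltM Mpr] := prime_above (N + B + B).
exists M; first by apply: leq_ltn_trans ltM; rewrite -addnA leq_addr.
rewrite /lattice_size Mpr /=; apply/eqP; apply: card_in_imfset => k k' kI k'I.
move=> /matrixP eqkk'; apply/matrixP => i a; rewrite ord1.
have := eqkk' 0 a; rewrite !mxE => /eqP; rewrite eqz_mod_dvd dvdzE absz_nat.
move=> dvM; have [/eqP|] := posnP `|(k 0%R a - k' 0%R a)%R|%N.
  by rewrite absz_eq0 subr_eq0 => /eqP.
move=> /dvdn_leq /(_ dvM); rewrite leqNgt => /negP[].
apply: leq_ltn_trans ltM; have := ltB _ a kI; have := ltB _ a k'I.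
move: (k 0 a) (k' 0 a) => x y; lia.
Qed.

Definition smallest_sizes (R : realType) (lambda : R) (n : nat) : {fset nat} :=
  n_smallest (fun M => lattice_size M && (lambda < M%:R :> R)) n.

Lemma smallest_sizes_spec (R : realType) (lambda : R) (n : nat) :
  (forall M : nat, (M \in smallest_sizes lambda n) =
    [&& lattice_size M, lambda < M%:R :> R &
     (count (fun q => lattice_size q && (lambda < q%:R :> R)%R) (iota 0 M) < n)%N]) /\
  #|` smallest_sizes lambda n| = n.
Proof.
pose Q := fun M : nat => lattice_size M && (lambda < M%:R :> R).
have [N|fin cardS] := @card_n_smallest Q n.
  have [M ltM LM] := lattice_size_unbounded (N + `|Num.ceil lambda|).
  exists M; first by apply: leq_ltn_trans ltM; exact: leq_addr.
  rewrite /Q LM /=; apply: (le_lt_trans (ceil_ge lambda)).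
  by rewrite pmulrn ltr_int; move: (Num.ceil lambda) ltM => u; lia.
split=> // M; rewrite in_fset_set // andbA; apply/idP/idP.
  by rewrite inE => -[QM ltM]; apply/andP.
by move=> /andP[QM ltM]; rewrite inE.
Qed.

End sizes.

(** * Discrete random choices *)

Section random_choices.
Variables (R : realType) (disp : measure_display) (Omega : measurableType disp).
Variable P : probability Omega R.
Local Open Scope classical_set_scope.

Definition discrete_rv (T : countType) (X : Omega -> T) :=
  forall x, measurable (X @^-1` [set x]).

Definition uniform_on (T : countType) (X : Omega -> T) (A : {fset T}) :=
  forall x, P (X @^-1` [set x]) = ((x \in A)%:R / #|` A|%:R)%:E.

(* For countably valued variables it suffices to test singletons. *)
Definition mutually_independent (s : nat) (T : countType)
    (X : Omega -> {ffun 'I_s -> T}) :=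
  forall (J : {set 'I_s}) (x : 'I_s -> T),
    P [set w | forall l, l \in J -> X w l = x l] =
    (\prod_(l in J) P [set w | X w l = x l])%E.

Definition drawn_with_replacement (s : nat) (T : countType)
    (X : Omega -> {ffun 'I_s -> T}) (A : {fset T}) :=
  (forall l : 'I_s, uniform_on (fun w => X w l) A) /\ mutually_independent X.

Definition injections (s : nat) (T : countType) (A : {fset T}) :
    {fset {ffun 'I_s -> T}} :=
  [fset [ffun l => val ((f : {ffun 'I_s -> A}) l)] |
     f in [pred f : {ffun 'I_s -> A} | injectiveb f]]%fset.

Lemma in_injections (s : nat) (T : countType) (A : {fset T})
    (f : {ffun 'I_s -> T}) :
  (f \in injections s A) = [forall l, f l \in A] && injectiveb f.
Proof.
apply/imfsetP/andP => [[g /= /injectiveP g_inj ->]|[/forallP fA f_inj]].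
  split; first by apply/forallP => l; rewrite ffunE; exact: fsvalP.
  by apply/injectiveP => i j; rewrite !ffunE => /val_inj /g_inj.
exists [ffun l => [` fA l]%fset]; last by apply/ffunP => l; rewrite !ffunE.
apply/injectiveP => i j; rewrite !ffunE => /(congr1 val) /=.
exact: (injectiveP _ f_inj).
Qed.

Definition drawn_without_replacement (s : nat) (T : countType)
    (X : Omega -> {ffun 'I_s -> T}) (A : {fset T}) :=
  uniform_on X (injections s A).

(* [0, M - 1]^d intersected with Z^d *)
Definition box (d M : nat) : {fset 'rV[int]_d} :=
  [fset map_mx (fun a : 'I_M => (a : nat)%:Z) v | v in 'rV['I_M]_d]%fset.

(* Conditionally on the lattice sizes, the vectors z_l are independent and z_l
   is uniform on the box of side M_l. *)
Definition drawn_generating_vectors (d s : nat)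
    (M : Omega -> {ffun 'I_s -> nat}) (z : Omega -> {ffun 'I_s -> 'rV[int]_d}) :=
  forall (m : {ffun 'I_s -> nat}) (v : {ffun 'I_s -> 'rV[int]_d}),
    P [set w | M w = m /\ z w = v] =
    (P [set w | M w = m] *
     (\prod_(l < s) ((v l \in box d (m l))%:R / #|` box d (m l)|%:R))%:E)%E.

End random_choices.

(* Main.v *)
(* Say that the lattice (z, M) separates k in I if k.z differs modulo M from k'.z
   for all other k' in I. If every k in I is separated by one of the lattices,
   then the Fourier matrix has full column rank by aliasing. For a prime M with
   k <> k' modulo M, a uniform z satisfies (k - k').z = 0 modulo M with
   probability at most 1/M, so (z, M) fails to separate k with probability at
   most (T - 1)/M <= 1/c, whatever the admissible M is. Conditionally on the
   sizes the z_l are independent, so some k is separated by none of the s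
   lattices with probability at most T c^(-s), and this is at most delta because
   2 (1 - 1/c)^2 <= ln c. *)

Require Import Defs.
From HB Require Import structures.
From mathcomp Require Import all_boot all_order all_algebra finmap.
From mathcomp Require Import all_classical all_reals all_analysis complex.
From mathcomp Require Import ring lra.

Set Implicit Arguments.
Unset Strict Implicit.
Unset Printing Implicit Defensive.
Import Order.TTheory GRing.Theory Num.Theory.
Local Open Scope classical_set_scope.
Local Open Scope ring_scope.

(** * The character [expi2pi] and its values at rational points *)

Section exponential.
Variable R : realType.

Lemma expi2piD (x y : R) : expi2pi (x + y) = expi2pi x * expi2pi y.
Proof.
rewrite /expi2pi mulrDr cosD sinD; apply/eqP; rewrite eq_complex /=.
by rewrite eqxx [X in _ == X]addrC eqxx.
Qed.

Lemma expi2pi0 : expi2pi (0 : R) = 1.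
Proof. by rewrite /expi2pi mulr0 cos0 sin0. Qed.

Lemma expi2pi_nat (n : nat) : expi2pi (n%:R : R) = 1.
Proof.
elim: n => [|n IHn]; first exact: expi2pi0.
rewrite -addn1 natrD expi2piD IHn mul1r /expi2pi mulr1 mulr_natl.
by rewrite cos2pi sin2pi.
Qed.

Lemma expi2pi_int (n : int) : expi2pi (n%:~R : R) = 1.
Proof.
case: n => n; first exact: expi2pi_nat.
have := expi2piD (n.+1%:R) (- n.+1%:R : R).
by rewrite subrr expi2pi0 expi2pi_nat mul1r NegzE rmorphN /= => <-.
Qed.

Lemma expi2piMn (x : R) (n : nat) : expi2pi (x * n%:R) = expi2pi x ^+ n.
Proof.
elim: n => [|n IHn]; first by rewrite mulr0 expi2pi0.
by rewrite exprSr -IHn -expi2piD -addn1 natrD mulrDr mulr1.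
Qed.

(** The real part is [1 - 2 sin(pi x)^2], and the sine is positive on [(0, pi)]. *)
Lemma expi2pi_neq1 (x : R) : 0 < x < 1 -> expi2pi x != 1.
Proof.
move=> /andP[x0 x1]; apply/eqP => /(congr1 (@complex.Re R)) /=.
have -> : 2 * pi * x = (pi * x) *+ 2 by rewrite -mulrA mulr_natl.
rewrite cos_mulr2n cos2sin2 => h.
have : 0 < sin (pi * x).
  apply: sin_gt0_pi; rewrite mulr_gt0 ?pi_gt0 //=.
  by rewrite gtr_pMr // pi_gt0.
move=> /gt_eqF /negP[]; rewrite -sqrf_eq0; apply/eqP; lra.
Qed.

(** Euclidean division of [a] by [M] splits off an integer, which the character ignores; a nonzero
    remainder would leave a point of [(0, 1)]. *)
Lemma expi2pi_eq1_dvd (a : int) (M : nat) : (0 < M)%N ->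
  expi2pi (a%:~R / M%:R : R) = 1 -> (M%:Z %| a)%Z.
Proof.
move=> M0; have MR : (M%:R : R) != 0 by rewrite pnatr_eq0 -lt0n.
have M0Z : M%:Z != 0 by rewrite eqz_nat -lt0n.
rewrite {1}(divz_eq a M) intrD intrM mulrDl -pmulrn mulfK // expi2piD.
rewrite expi2pi_int mul1r => /eqP; apply: contraTT => ndvd.
apply: expi2pi_neq1; rewrite divr_gt0 ?ltr0n //=; last first.
  by rewrite ltr0z lt_neqAle modz_ge0 // andbT eq_sym; apply: contra ndvd => /eqP /dvdz_mod0P.
by rewrite ltr_pdivrMr ?ltr0n // mul1r pmulrn ltr_int ltz_pmod.
Qed.

End exponential.

(** * Characters on a lattice and linear independence of the columns *)

Section lattice_rank.
Variables (R : realType) (d : nat).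

Definition int_dotp (u z : 'rV[int]_d) : int := \sum_(a < d) u 0 a * z 0 a.

Lemma expi2pi_dotp_fract (k : 'rV[int]_d) (x : 'rV[R]_d) :
  expi2pi (dotp k (fract_vec x)) = expi2pi (dotp k x).
Proof.
have -> : dotp k (fract_vec x) =
    dotp k x + (- \sum_a k 0 a * Num.floor (x 0 a))%:~R.
  rewrite /dotp rmorphN rmorph_sum /= -sumrB; apply: eq_bigr => a _.
  by rewrite mxE mulrBr intrM.
by rewrite expi2piD expi2pi_int mulr1.
Qed.

(** Along the nodes a character runs through the powers of one root of unity, so sums over a lattice
    become geometric sums. *)
Lemma expi2pi_dotp_lattice (k z : 'rV[int]_d) (M j : nat) :
  expi2pi (dotp k (fract_vec ((j%:R / M%:R) *: map_mx intr z))) =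
  expi2pi ((int_dotp k z)%:~R / M%:R : R) ^+ j.
Proof.
rewrite expi2pi_dotp_fract -expi2piMn; congr (expi2pi _).
rewrite /dotp /int_dotp rmorph_sum /= mulr_suml mulr_suml; apply: eq_bigr => a _.
rewrite !mxE rmorphM /=; ring.
Qed.

(* Aliasing: testing a relation between the columns against the character of k
   on a lattice separating k from the rest of I kills all coefficients but that
   of k. *)
Lemma full_column_rank_fourier (X : {fset 'rV[R]_d}) (I : {fset 'rV[int]_d}) :
  (forall k, k \in I -> exists M z, [/\ (0 < M)%N,
     {subset rank1_lattice R z M <= X} &
     forall k', k' \in I -> k' != k -> ~~ (M%:Z %| int_dotp (k' - k) z)%Z]) ->
  full_column_rank (fourier_mx X I).
Proof.
move=> sep; rewrite /full_column_rank -mxrank_tr.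
apply: inj_row_free => v vA; apply/rowP => q0; rewrite mxE.
have ltI (q : 'I_(#|` I|)) : (q < size I)%N by exact: ltn_ord.
have [|M [z [M0 subX Msep]]] := sep I`_q0; first exact: mem_nth.
pose e (q : 'I_(#|` I|)) : R[i] := expi2pi ((int_dotp I`_q z)%:~R / M%:R : R).
(* [e'] is the inverse of [e q0]. *)
pose e' : R[i] := expi2pi (- ((int_dotp I`_q0 z)%:~R / M%:R) : R).
have node (j : 'I_M) : \sum_q v 0 q * (e q) ^+ j = 0.
  pose x : 'rV[R]_d := fract_vec (((j : nat)%:R / M%:R) *: map_mx intr z).
  have xX : x \in X.
    by apply: subX; apply/imfsetP; exists (j : nat); rewrite //= mem_iota /= ltn_ord.
  have px : (index x X < #|` X|)%N by rewrite index_mem.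
  have /rowP /(_ (Ordinal px)) := vA; rewrite !mxE => vA0; rewrite -[RHS]vA0.
  apply: eq_bigr => q _; rewrite !mxE /= nth_index //.
  by rewrite /x expi2pi_dotp_lattice.
(* After exchanging the sums, [v 0 q] is multiplied by the geometric sum of ratio [e q * e']. *)
have : \sum_(j < M) (\sum_q v 0 q * (e q) ^+ j) * e' ^+ j = 0.
  by rewrite big1 // => j _; rewrite node mul0r.
under eq_bigr => j _ do rewrite mulr_suml.
rewrite exchange_big (bigD1 q0) //= [X in _ + X]big1 ?addr0; last first.
  move=> q qq0; under eq_bigr => j _ do rewrite -mulrA -exprMn.
  rewrite -mulr_sumr; apply/eqP; rewrite mulf_eq0; apply/orP; right.
  set w := e q * e'.
  have wE : w = expi2pi ((int_dotp (I`_q - I`_q0) z)%:~R / M%:R : R).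
    rewrite /w /e /e' -expi2piD -mulNr -mulrDl -rmorphN -rmorphD /=.
    congr (expi2pi (_%:~R / _)); rewrite /int_dotp -sumrN -big_split /=.
    by apply: eq_bigr => a _; rewrite !mxE mulrDl mulNr.
  have w1 : w - 1 != 0.
    rewrite subr_eq0; apply/eqP; rewrite wE => /(expi2pi_eq1_dvd M0).
    apply/negP; apply: Msep; first exact: mem_nth.
    by rewrite nth_uniq // fset_uniq.
  (* [w] is an [M]-th root of unity other than 1, so [w ^+ M - 1 = (w - 1) * sum] forces the
     geometric sum to vanish. *)
  have : w ^+ M - 1 = 0.
    rewrite wE -expi2piMn divfK ?expi2pi_int ?subrr //.
    by rewrite pnatr_eq0 -lt0n.
  by move/eqP; rewrite subrX1 mulf_eq0 (negPf w1).
under eq_bigr => j _ do rewrite -mulrA -exprMn.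
(* For [q0] the ratio is 1 and the geometric sum is [M], which is nonzero; hence [v 0 q0 = 0]. *)
have -> : e q0 * e' = 1 by rewrite /e /e' -expi2piD subrr expi2pi0.
under eq_bigr => j _ do rewrite expr1n mulr1.
rewrite sumr_const card_ord => /eqP; rewrite mulrn_eq0 -[M == 0%N]negbK -lt0n M0.
by move/eqP.
Qed.

End lattice_rank.

(** * The choice of the number of lattices *)

Lemma ln_le_quadratic (R : realType) (q : R) : 0 < q < 1 ->
  ln q <= - (2 * (1 - q) ^+ 2).
Proof.
move=> /andP[q0 q1].
(* [f] vanishes at 1 and has derivative [(1 - 2x)^2 / x >= 0], so it is at most 0 to the left of
   1. *)
pose f (x : R) := ln x + 2 * (1 - x) ^+ 2.
pose df (x : R) := x^-1 - 4 * (1 - x).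
have fdf (x : R) : 0 < x -> is_derive x 1 f (df x).
  move=> x0; have ? := is_derive1_ln x0.
  rewrite /f; apply: is_derive_eq; rewrite /df /GRing.scale /=; ring.
have [||x /[!in_itv]/= /andP[qx x1]] := @MVT _ f df q 1 q1.
- by move=> x /[!in_itv]/= /andP[qx _]; apply: fdf; exact: lt_trans qx.
- apply: derivable_within_continuous => x /[!in_itv]/= /andP[qx _].
  by apply: ex_derive; apply: fdf; exact: lt_le_trans qx.
have x0 : 0 < x by exact: lt_trans qx.
have : 0 <= df x.
  have -> : df x = (1 - 2 * x) ^+ 2 / x by rewrite /df; field; exact: lt0r_neq0.
  by rewrite divr_ge0 ?sqr_ge0 // ltW.
rewrite /f ln1 => df0 E.
have : 0 <= df x * (1 - q) by rewrite mulr_ge0 // subr_ge0 ltW.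
rewrite -E; lra.
Qed.

(** In logarithms the claim is [ln T - ln delta <= s ln c]. Since [1 - 1/c] is the inverse of
    [c / (c - 1)], the bound [2 (1 - 1/c)^2 <= ln c] cancels exactly the factor in the definition of
    [s]. *)
Lemma union_bound_le (R : realType) (T s : nat) (c delta : R) :
  (0 < T)%N -> 0 < delta -> 1 < c ->
  s%:Z = Num.ceil ((c / (c - 1)) ^+ 2 * ((ln T%:R - ln delta) / 2)) ->
  T%:R * c^-1 ^+ s <= delta.
Proof.
move=> T0 delta0 c1 sE; have c0 : 0 < c by exact: lt_trans c1.
have := ceil_ge ((c / (c - 1)) ^+ 2 * ((ln T%:R - ln delta) / 2)).
rewrite -sE -pmulrn => le_s.
have q01 : 0 < c^-1 < 1 by rewrite invr_gt0 c0 invf_lt1.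
have /andP[q0 _] := q01.
rewrite -ler_ln ?posrE ?mulr_gt0 ?exprn_gt0 ?ltr0n //.
rewrite lnM ?posrE ?exprn_gt0 ?ltr0n // lnXn // -[_ *+ s]mulr_natl.
have := ler_wpM2l (ler0n R s) (ln_le_quadratic q01).
have cN : c - 1 != 0 by rewrite subr_eq0 gt_eqF.
have c'N : c != 0 by rewrite gt_eqF.
have : 2 * (1 - c^-1) ^+ 2 * ((c / (c - 1)) ^+ 2 * ((ln T%:R - ln delta) / 2)) <= 2 * (1 - c^-1) ^+ 2 * s%:R.
  by apply: ler_wpM2l => //; rewrite mulr_ge0 // sqr_ge0.
have -> : 2 * (1 - c^-1) ^+ 2 * ((c / (c - 1)) ^+ 2 * ((ln T%:R - ln delta) / 2)) = ln T%:R - ln delta.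
  by field; rewrite c'N cN.
lra.
Qed.

(** * Counting solutions of a linear congruence in a box *)

Section box.
Variables (d p : nat).

Definition int_of_box (v : 'rV['I_p]_d) : 'rV[int]_d :=
  map_mx (fun a : 'I_p => (a : nat)%:Z) v.

Lemma int_of_box_inj : injective int_of_box.
Proof.
move=> v w /matrixP E; apply/matrixP => i j; have := E i j; rewrite !mxE.
by case=> /val_inj.
Qed.

Lemma card_box : #|` box d p| = (p ^ d)%N.
Proof.
rewrite card_imfset; last exact: int_of_box_inj.
by rewrite -cardE card_mx card_ord mul1n.
Qed.

(** The ambient set [B] provides one finite type for vectors taken from boxes of different sides. *)
Lemma sum_box (R : nmodType) (B : {fset 'rV[int]_d}) (F : 'rV[int]_d -> R) :
  (box d p `<=` B)%fset ->
  \sum_(u : B | val u \in box d p) F (val u) = \sum_v F (int_of_box v).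
Proof.
move=> boxB; rewrite -(big_seq_fsetE _ _ (mem (box d p)) F) /= big_mkcond /=.
rewrite -(big_fset_incl _ boxB); last by move=> x _ /negPf ->.
rewrite -big_mkcond -big_seq big_imfset /=; first by rewrite big_enum.
by move=> v w _ _; exact: int_of_box_inj.
Qed.

(* Translating the coordinate a of a solution by t = 0, ..., p - 1 gives p
   vectors, distinct for distinct pairs (solution, t). *)
Lemma card_box_dvd (u : 'rV[int]_d) (a : 'I_d) : prime p -> ~~ (p%:Z %| u 0%R a)%Z ->
  (#|[set v | (p%:Z %| int_dotp u (int_of_box v))%Z]%SET| * p <= p ^ d)%N.
Proof.
move=> p_pr ndvd; have p_gt0 := prime_gt0 p_pr.
set S := finset _.
pose sh (vt : 'rV['I_p]_d * 'I_p) : 'rV['I_p]_d :=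
  \row_b if b == a then Ordinal (ltn_pmod (vt.1 0 b + vt.2) p_gt0) else vt.1 0 b.
have sh_inj : {in finset.setX S [set: 'I_p] &, injective sh}.
  move=> [v t] [v' t']; rewrite !inE /= => /andP[Sv _] /andP[Sv' _] /rowP E.
  have Ene b : b != a -> v 0 b = v' 0 b.
    by move=> ba; have := E b; rewrite !mxE (negPf ba).
  have Ea : v 0 a = v' 0 a.
    (* Only the coordinate [a] survives in the difference; [u 0 a] is prime to [p], so the two
       entries agree modulo [p], and both are below [p]. *)
    have : (p%:Z %| int_dotp u (int_of_box v) - int_dotp u (int_of_box v'))%Z.
      by rewrite rpredB.
    rewrite /int_dotp -sumrB (bigD1 a) //= big1 ?addr0; last first.
      by move=> b ba; rewrite !mxE Ene // subrr.
    rewrite -mulrBr Gauss_dvdzr ?coprimezE ?prime_coprime //.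
    rewrite !mxE -eqz_mod_dvd => /eqP.
    by rewrite !modz_nat => -[]; rewrite !modn_small // => /val_inj.
  have -> : v = v'.
    by apply/rowP => b; have [->|/Ene] := eqVneq b a.
  congr (_, _); have := E a; rewrite !mxE eqxx Ea => /(congr1 val) /= /eqP.
  by rewrite eqn_modDl !modn_small // => /eqP /val_inj.
have <- : #|finset.setX S [set: 'I_p]| = (#|S| * p)%N.
  by rewrite cardsX cardsT card_ord.
rewrite -(card_in_imset sh_inj); apply: leq_trans (max_card _) _.
by rewrite card_mx card_ord mul1n.
Qed.

End box.

(** * Failure probabilities for one lattice and for several independent ones *)

Definition separates d (I : {fset 'rV[int]_d}) (k : 'rV[int]_d) (m : nat)
    (u : 'rV[int]_d) : bool :=
  [forall k' : I, (val k' != k) ==> ~~ (m%:Z %| int_dotp (val k' - k) u)%Z].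

Lemma nonseparating_le (R : realFieldType) d (I : {fset 'rV[int]_d}) k m
    (c : R) (B : {fset 'rV[int]_d}) :
  k \in I -> lattice_size I m -> 0 < c -> c * (#|` I|%:R - 1) <= m%:R ->
  (box d m `<=` B)%fset ->
  \sum_(u : B | ~~ separates I k m (val u))
     ((val u \in box d m)%:R / #|` box d m|%:R) <= c^-1.
Proof.
move=> kI /andP[m_pr /eqP m_inj] c0 cm boxB.
have m0 : (0 < m)%N := prime_gt0 m_pr.
have md0 : 0 < (m ^ d)%:R :> R by rewrite ltr0n expn_gt0 m0.
rewrite card_box -mulr_suml ler_pdivrMr //.
have -> : \sum_(u : B | ~~ separates I k m (val u)) (val u \in box d m)%:R =
    \sum_(v : 'rV['I_m]_d) (~~ separates I k m (int_of_box v))%:R :> R.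
  rewrite -(sum_box (fun u => (~~ separates I k m u)%:R) boxB).
  rewrite big_mkcond [RHS]big_mkcond; apply: eq_bigr => u _.
  by case: (separates _ _ _ _); case: (_ \in _).
pose S (k' : I) := [set v : 'rV['I_m]_d | (m%:Z %| int_dotp (val k' - k) (int_of_box v))%Z]%SET.
have bound (k' : I) : val k' != k -> #|S k'|%:R <= (m ^ d)%:R / m%:R :> R.
  move=> k'k; rewrite ler_pdivlMr ?ltr0n // -natrM ler_nat.
  suff [a nd] : exists a, ~~ (m%:Z %| (val k' - k)%R 0%R a)%Z by exact: card_box_dvd nd.
  apply/existsP; rewrite -negb_forall; apply: contra k'k => /forallP dv.
  (* Reduction modulo [m] preserves the cardinality of [I], hence is injective on it; so [k' - k]
     cannot have all its coordinates divisible by [m]. *)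
  have/card_in_imfsetP mod_inj : #|` [fset mod_vec m k | k in I]%fset| == #|` I|.
    by rewrite -m_inj.
  apply/eqP/(mod_inj _ _ (fsvalP k') kI).
  apply/rowP => a; rewrite !mxE; apply/eqP; rewrite eqz_mod_dvd.
  by have := dv a; rewrite !mxE.
(* Union bound: a vector that fails to separate [k] lies in some [S k']. *)
apply: (@le_trans _ _ (\sum_(k' : I | val k' != k) #|S k'|%:R)).
  under [leRHS]eq_bigr => k' _ do rewrite -sum1_card natr_sum big_mkcond.
  rewrite exchange_big /=; apply: ler_sum => v _.
  have [//|] := boolP (separates _ _ _ _); first by move=> _; apply: sumr_ge0 => *; case: ifP.
  rewrite negb_forall => /existsP[k']; rewrite negb_imply negbK => /andP[k'k dv].
  rewrite (bigD1 k') //= inE dv lerDl; apply: sumr_ge0 => *; by case: ifP.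
apply: le_trans (ler_sum _ bound) _.
rewrite sumr_const -[leLHS]mulr_natr.
have -> : #|[pred k' : I | val k' != k]| = #|` I|.-1.
  rewrite cardfE -(cardC1 [` kI]%fset); apply: eq_card => k'.
  by rewrite !inE -val_eqE.
have I0 : (0 < #|` I|)%N by rewrite cardfs_gt0; apply/fset0Pn; exists k.
rewrite mulrAC -mulrA mulrC; apply: ler_wpM2r; first exact: ltW.
rewrite ler_pdivrMr ?ltr0n // mulrC ler_pdivlMr //.
by rewrite -subn1 natrB // mulrC.
Qed.

(** The products of weights form a product probability on functions. By independence a fixed [k]
    fails at every [j] with probability at most [q ^+ #|J|]; a union bound over [K] concludes. *)
Lemma sum_prod_covering (R : realFieldType) (J K V : finType) (g : J -> V -> R)
    (ok : K -> J -> V -> bool) (q : R) :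
  (forall j v, 0 <= g j v) -> (forall j, \sum_v g j v = 1) ->
  (forall k j, \sum_(v | ~~ ok k j v) g j v <= q) ->
  1 - #|K|%:R * q ^+ #|J| <=
  \sum_(f : {ffun J -> V} | [forall k, exists j, ok k j (f j)]) \prod_j g j (f j).
Proof.
move=> g0 g1 gq; pose G (f : {ffun J -> V}) := \prod_j g j (f j).
have G0 f : 0 <= G f by exact: prodr_ge0.
have G1 : \sum_f G f = 1 by rewrite /G -(bigA_distr_bigA g) big1.
rewrite lerBlDr -[leLHS]G1.
rewrite (bigID (fun f : {ffun J -> V} => [forall k, exists j, ok k j (f j)])) /=.
rewrite lerD2l.
apply: (@le_trans _ _ (\sum_k \sum_(f : {ffun J -> V} | [forall j, ~~ ok k j (f j)]) G f)).
  rewrite [leLHS]big_mkcond; under [leRHS]eq_bigr => k _ do rewrite big_mkcond.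
  rewrite exchange_big /=; apply: ler_sum => f _; case: ifPn => [|_]; last first.
    by apply: sumr_ge0 => k _; case: ifP.
  rewrite negb_forall => /existsP[k]; rewrite negb_exists => bad.
  by rewrite (bigD1 k) //= bad lerDl; apply: sumr_ge0 => *; case: ifP.
apply: le_trans (_ : \sum_(k : K) q ^+ #|J| <= _); last first.
  by rewrite sumr_const mulr_natl.
apply: ler_sum => k _.
have -> : \sum_(f : {ffun J -> V} | [forall j, ~~ ok k j (f j)]) G f =
    \prod_j \sum_(v | ~~ ok k j v) g j v.
  rewrite bigA_distr_big_dep; apply: eq_bigl => f.
  by apply/forallP/familyP.
rewrite -prodr_const; apply: ler_prod => j _.
by rewrite gq andbT sumr_ge0.
Qed.

(** * Laws of the random choices as finite sums *)

Definition val_ffun (s : nat) (T : choiceType) (A : {fset T})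
  (f : {ffun 'I_s -> A}) : {ffun 'I_s -> T} := [ffun l => val (f l)].

Lemma val_ffun_inj s (T : choiceType) (A : {fset T}) :
  injective (@val_ffun s T A).
Proof.
move=> f g /ffunP E; apply/ffunP => l; apply: val_inj.
by have := E l; rewrite !ffunE.
Qed.

Section random.
Variables (R : realType) (disp : measure_display) (Omega : measurableType disp).
Variable P : probability Omega R.

Lemma discrete_rv_measurable (T : countType) (X : Omega -> T) (A : set T) :
  discrete_rv X -> measurable (X @^-1` A).
Proof.
move=> Xrv; have -> : X @^-1` A =
    \bigcup_(x : T) (if x \in A then X @^-1` [set x] else set0).
  apply/seteqP; split=> w /=.
    by move=> Aw; exists (X w) => //; rewrite mem_set.
  by move=> [x _]; case: ifP => // /set_mem Ax /= ->.
apply: countable_bigcupT_measurable; first exact: countableP.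
by move=> x; case: ifP => // _; exact: Xrv.
Qed.

(** The fibres of [X] over distinct values are disjoint measurable parts of the event. This reduces
    a lower bound on its probability to a finite sum. *)
Lemma sum_discrete_le (T : countType) (X : Omega -> T) (J : finType)
    (x : J -> T) (D : pred J) (A : set T) :
  discrete_rv X -> injective x -> (forall j, D j -> A (x j)) ->
  (\sum_(j | D j) P (X @^-1` [set x j]) <= P (X @^-1` A))%E.
Proof.
move=> Xrv x_inj DA.
have tr : trivIset [set` D] (fun j => X @^-1` [set x j]).
  by move=> i j _ _ [w [/= wi wj]]; apply: x_inj; rewrite -wi -wj.
rewrite -big_filter fsbig_seq ?filter_uniq ?index_enum_uniq //.
have -> : [set` [seq j <- index_enum J | D j]] = [set` D].
  by apply/seteqP; split=> j /=; rewrite mem_filter mem_index_enum andbT.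
rewrite -measure_fin_bigcup //.
apply: le_measure; rewrite ?inE; first 1 last.
- exact: discrete_rv_measurable.
- by move=> w [j Dj /= ->]; exact: DA.
- by apply: fin_bigcup_measurable.
Qed.

(** Treats both ways of drawing at once: what follows uses only that the sizes have some law carried
    by tuples from [A]. It is constant on all tuples in the first case and on the injective ones in
    the second. *)
Lemma drawn_sizes_law (s n : nat) (A : {fset nat}) (M : Omega -> {ffun 'I_s -> nat}) :
  #|` A| = n -> (0 < n)%N ->
  drawn_with_replacement P M A \/ (s <= n)%N /\ drawn_without_replacement P M A ->
  exists pm : {ffun 'I_s -> A} -> R,
    [/\ forall m, P [set w | M w = val_ffun m] = (pm m)%:E,
        forall m, 0 <= pm m & \sum_m pm m = 1].
Proof.
move=> cardA n0 [[unif indep]|[sn unif]].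
  exists (fun _ => \prod_(l < s) n%:R^-1); split.
  - move=> m; have := indep [set: 'I_s]%SET (val_ffun m).
    have -> : [set w | forall l, l \in [set: 'I_s]%SET -> M w l = val_ffun m l]
        = [set w | M w = val_ffun m].
      apply/seteqP; split=> w /= => [E|-> //].
      by apply/ffunP => l; apply: E; rewrite inE.
    move=> ->; rewrite -prodEFin; apply: eq_big => [l|l _]; first by rewrite inE.
    by have := unif l (val_ffun m l); rewrite cardA ffunE fsvalP mul1r.
  - by move=> _; apply: prodr_ge0 => l _; rewrite invr_ge0.
  - rewrite -(bigA_distr_bigA (fun (_ : 'I_s) (_ : A) => n%:R^-1 : R)) big1 // => l _.
    by rewrite sumr_const -cardfE cardA -[LHS]mulr_natr mulVf // pnatr_eq0 -lt0n.
pose inj (m : {ffun 'I_s -> A}) := val_ffun m \in injections s A.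
have injE m : inj m = injectiveb m.
  rewrite /inj in_injections; apply/andP/idP.
    case=> _ /injectiveP h; apply/injectiveP => i j E; apply: h.
    by rewrite !ffunE E.
  move=> /injectiveP h; split; first by apply/forallP => l; rewrite ffunE fsvalP.
  by apply/injectiveP => i j; rewrite !ffunE => /val_inj /h.
have card_inj : #|` injections s A| = #|[pred m | inj m]|.
  rewrite card_imfset; last exact: val_ffun_inj.
  by rewrite -cardE; apply: eq_card => m; rewrite !inE injE.
(* The number of injections is the falling factorial [n ^_ s], positive because [s <= n]. *)
have inj0 : (0 < #|` injections s A|)%N.
  rewrite card_inj (_ : #|_| = n ^_ s)%N ?ffact_gt0 //.
  have := card_inj_ffuns 'I_s A; rewrite -cardfE cardA card_ord => <-.
  by apply: eq_card => m; rewrite !inE injE.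
exists (fun m => (inj m)%:R / #|` injections s A|%:R); split.
- by move=> m; exact: unif.
- by move=> m; rewrite divr_ge0.
- rewrite -mulr_suml -natr_sum -big_mkcond sum1_card card_inj divff //.
  by rewrite -card_inj pnatr_eq0 -lt0n.
Qed.

End random.

(** * Averaging the bound for random generating vectors over the lattice sizes *)

Theorem theorem3p4 (R : realType) (d : nat) (d_gt0 : (0 < d)%N)
  (I : {fset 'rV[int]_d}) (T : nat) (cardI : #|` I| = T) (I_neq0 : I != fset0)
  (delta : R) (delta_gt0 : 0 < delta) (delta_lt1 : delta < 1)
  (c : R) (c_gt1 : 1 < c) (n : nat) (n_gt0 : (0 < n)%N)
  (lambda : R) (lambda_ge : c * (T%:R - 1) <= lambda)
  (s : nat)
  (sE : s%:Z = Num.ceil ((c / (c - 1)) ^+ 2 * ((ln T%:R - ln delta) / 2)))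
  (disp : measure_display) (Omega : measurableType disp)
  (P : probability Omega R)
  (M : Omega -> {ffun 'I_s -> nat}) (z : Omega -> {ffun 'I_s -> 'rV[int]_d})
  (Mz_rv : discrete_rv (fun w => (M w, z w)))
  (drawnM : drawn_with_replacement P M (smallest_sizes I lambda n) \/
            (s <= n)%N /\
            drawn_without_replacement P M (smallest_sizes I lambda n))
  (drawnz : drawn_generating_vectors P M z) :
  ((1 - delta)%:E <=
   P [set w | full_column_rank
       (fourier_mx (\big[fsetU/fset0]_(l < s) rank1_lattice R (z w l) (M w l))%fset I)])%E.
Proof.
have [sizeP card_size] := smallest_sizes_spec I lambda n.
set A := smallest_sizes I lambda n in sizeP card_size drawnM.
have [pm [pmE pm0 pm1]] := drawn_sizes_law card_size n_gt0 drawnM.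
have T0 : (0 < T)%N by rewrite -cardI cardfs_gt0.
have fail_le := union_bound_le T0 delta_gt0 c_gt1 sE.
(* The union of all boxes makes the type of the vectors finite and independent of the sizes
   drawn. *)
pose B := (\big[fsetU/fset0]_(m : A) box d (val m))%fset.
have boxB (m : A) : (box d (val m) `<=` B)%fset by exact: bigfcup_sup.
(* The conditional law of the [l]-th vector given the sizes [m], extended by zero to [B]. *)
pose g (m : {ffun 'I_s -> A}) (l : 'I_s) (u : B) : R :=
  (val u \in box d (val (m l)))%:R / #|` box d (val (m l))|%:R.
pose ok (m : {ffun 'I_s -> A}) (k : I) (l : 'I_s) (u : B) :=
  separates I (val k) (val (m l)) (val u).
pose good (mv : {ffun 'I_s -> A} * {ffun 'I_s -> B}) :=
  [forall k, exists l, ok mv.1 k l (mv.2 l)].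
pose x (mv : {ffun 'I_s -> A} * {ffun 'I_s -> B}) := (val_ffun mv.1, val_ffun mv.2).
have x_inj : injective x by move=> [m v] [m' v'] [/val_ffun_inj -> /val_ffun_inj ->].
pose F := [set y : {ffun 'I_s -> nat} * {ffun 'I_s -> 'rV[int]_d} |
  full_column_rank (fourier_mx
    (\big[fsetU/fset0]_(l < s) rank1_lattice R (y.2 l) (y.1 l))%fset I)].
have sizeA (m : A) : lattice_size I (val m) /\ lambda < (val m)%:R.
  by have := fsvalP m; rewrite sizeP => /and3P[].
have goodF mv : good mv -> F (x mv).
  move=> /forallP gd; apply: full_column_rank_fourier => k kI.
  have /existsP[l /forallP sep] := gd [` kI]%fset.
  exists (val (mv.1 l)), (val (mv.2 l)); split.
  - by have [/andP[/prime_gt0]] := sizeA (mv.1 l).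
  - move=> y yl; apply/bigfcupP; exists l; rewrite ?mem_index_enum //.
    by rewrite /= !ffunE.
  - by move=> k' k'I; have /implyP := sep [` k'I]%fset.
change ((1 - delta)%:E <= P ((fun w => (M w, z w)) @^-1` F))%E.
apply: (le_trans _ (sum_discrete_le P Mz_rv x_inj goodF)).
have PE mv : P ((fun w => (M w, z w)) @^-1` [set x mv]) =
    (pm mv.1 * \prod_l g mv.1 l (mv.2 l))%:E.
  have -> : (fun w => (M w, z w)) @^-1` [set x mv] =
      [set w | M w = val_ffun mv.1 /\ z w = val_ffun mv.2].
    by apply/seteqP; split=> w /= [-> ->].
  rewrite drawnz pmE EFinM; congr (_ * _%:E)%E.
  by apply: eq_bigr => l _; rewrite !ffunE.
under eq_bigr => mv _ do rewrite PE.
rewrite sumEFin lee_fin.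
rewrite -(pair_big_dep xpredT (fun m v => good (m, v))
  (fun m v => pm m * \prod_l g m l (v l))) /=.
(* Writing [1 - delta] as an average over the sizes leaves a bound to prove for each fixed [m]. *)
have -> : 1 - delta = \sum_m pm m * (1 - delta) by rewrite -mulr_suml pm1 mul1r.
apply: ler_sum => m _.
rewrite -mulr_sumr; apply: ler_wpM2l => //.
have m0 l : (0 < val (m l))%N by have [/andP[/prime_gt0]] := sizeA (m l).
(* The total failure bound is now [T * c^-1 ^+ s], at most [delta] by [fail_le]. *)
apply: (le_trans _ (sum_prod_covering (g := g m) (q := c^-1) (ok := ok m) _ _ _)).
- by rewrite lerD2l lerN2 card_ord -cardfE cardI.
- by move=> l u; rewrite divr_ge0.
- move=> l; rewrite /g -mulr_suml.
  have -> : \sum_(u : B) (val u \in box d (val (m l)))%:R =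
      \sum_(v : 'rV['I_(val (m l))]_d) 1 :> R.
    rewrite -(sum_box (fun=> 1) (boxB (m l))) [RHS]big_mkcond /=.
    by apply: eq_bigr => u _; case: (_ \in _).
  rewrite sumr_const card_box card_mx card_ord mul1n divff //.
  by rewrite pnatr_eq0 -lt0n expn_gt0 m0.
- move=> k l; have [ls lt] := sizeA (m l).
  apply: nonseparating_le => //.
  + exact: fsvalP.
  + exact: lt_trans c_gt1.
  + by rewrite cardI; apply: le_trans lambda_ge (ltW lt).
Qed.
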